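(* Let $A_1,\ldots,A_n$ ($n\ge 1$) be events in an arbitrary probability space, let $d\ge 1$ be an integer and let $p$ be a real number. Suppose that, for every $i\in\{1,\ldots,n\}$, the event $A_i$ is independent of the $\sigma$-algebra generated by all the remaining events except for at most $d$ of them, and that $\mathbb{P}(A_i)\le p$. If $$e\,p\,\bigl(d+\tfrac12\bigr)\le 1,$$ then $$\mathbb{P}\Bigl(\bigcap_{i=1}^n \overline{A_i}\Bigr)\ \ge\ \Bigl(\frac{d}{d+1}\Bigr)^n\ >\ e^{-n/d}.$$
   Context: $\overline{A}$ denotes the complement of the event $A$, and $e$ is the base of the natural logarithm. The independence hypothesis means: for each $i$ there is a set $J_i\subseteq\{1,\ldots,n\}\setminus\{i\}$ with $|J_i|\le d$ such that $\mathbb{P}(A_i\cap B)=\mathbb{P}(A_i)\,\mathbb{P}(B)$ for every $B$ in the $\sigma$-algebra generated by $\{A_j : j\ne i,\ j\notin J_i\}$. *)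

(* Defs.v *)
From HB Require Import structures.
From mathcomp Require Import all_boot all_order all_algebra.
From mathcomp Require Import all_classical all_reals all_analysis.

Set Implicit Arguments.
Unset Strict Implicit.
Unset Printing Implicit Defensive.

Import Order.TTheory GRing.Theory Num.Theory.

Local Open Scope classical_set_scope.
Local Open Scope ereal_scope.

Definition independent_of_system (disp : measure_display)
    (T : measurableType disp) (R : realType) (P : probability T R)
    (E : set T) (F : set (set T)) : Prop :=
  forall B : set T, F B -> P (E `&` B) = P E * P B.

(* [J] is the exceptional set of the event [A i]; it may depend on [i], and no
   symmetry between the exceptional sets of different events is required. *)
Definition independent_but_for_at_most (disp : measure_display)
    (T : measurableType disp) (R : realType) (P : probability T R)
    (n : nat) (A : 'I_n -> set T) (d : nat) (i : 'I_n) : Prop :=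
  exists J : {set 'I_n},
    [/\ i \notin J, (#|J| <= d)%N &
        independent_of_system P (A i)
          <<s [set A j | j in [set j : 'I_n | j != i /\ j \notin J]] >>].

(* Main.v *)
(** Write [f S] for the probability that no [A j] with [j] in [S] occurs, and
    put [q = d / (d + 1)].  Adding one index [i] to [S] decreases [f] at most by
    the factor [q]: by induction on [#|S|], splitting [S] into its part inside
    the exceptional set [J] of [i], on which the induction hypothesis costs at
    most [q ^ d], and its part outside [J], from which [A i] is independent.
    This only requires [p <= (1 - q) * q ^ d].

    That inequality amounts to [(1 + x) ^ (d + 1) <= e (1 + x / 2)] with
    [x = 1 / d].  After taking logarithms and multiplying by [x], the difference
    of the two sides vanishes at [0] and has derivative [u - ln (1 + u) >= 0]
    in [x], where [u = x / (2 + x)]. *)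
Require Import Defs.
From HB Require Import structures.
From mathcomp Require Import all_boot all_order all_algebra.
From mathcomp Require Import all_classical all_reals all_analysis.
From mathcomp Require Import ring lra.

Set Implicit Arguments.
Unset Strict Implicit.
Unset Printing Implicit Defensive.

Import Order.TTheory GRing.Theory Num.Theory.

Local Open Scope ring_scope.

(** The elements of [U] are added to [V] one at a time, each costing a factor [q]. The step is
    required only for [W] proper in [U :|: V], so that a strong induction on cardinality can supply
    it. *)
Lemma setfun_ge_chain (R : realFieldType) (I : finType) (f : {set I} -> R)
    (q : R) (U V : {set I}) :
    0 <= q -> [disjoint U & V] ->
    (forall (i : I) (W : {set I}), (W \proper U :|: V)%SET ->
      q * f W <= f (i |: W)%SET) ->
  q ^+ #|U| * f V <= f (U :|: V)%SET.
Proof.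
move=> q_ge0; elim: {U}_.+1 {-2}U (ltnSn #|U|) => // k IHk U Uk dUV step.
have [->|[j jU]] := finset.set_0Vmem U; first by rewrite cards0 expr0 mul1r finset.set0U.
have jV : j \notin V by rewrite (disjointFr dUV jU).
have pr : ((U :\ j) :|: V \proper U :|: V)%SET.
  rewrite properE finset.setSU ?finset.subsetDl//; apply/fintype.subsetPn; exists j.
    by rewrite inE jU.
  by rewrite !inE eqxx (negbTE jV).
rewrite (cardsD1 j) jU exprS -mulrA -[in leRHS](finset.setD1K jU) -finset.setUA.
apply: le_trans (step j _ pr); apply: ler_wpM2l => //.
apply: IHk => [||i W /proper_trans/(_ pr)]; last exact: step.
- by rewrite (cardsD1 j) jU in Uk.
- exact: disjointWl (finset.subsetDl _ _) dUV.
Qed.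

(** The probabilistic content is reduced to set functions: [f S - f (i |: S)] stands for the
    probability that [A i] occurs and no [A j] with [j] in [S] does. The second-to-last hypothesis
    is monotonicity of measure, the last one is independence. *)
Lemma setfun_local_lemma (R : realFieldType) (I : finType)
    (f : {set I} -> R) (d : nat) (p q : R) :
    0 <= q <= 1 -> p <= (1 - q) * q ^+ d ->
    (forall S, 0 <= f S) ->
    (forall (i : I) (S S' : {set I}), S' \subset S ->
      f S - f (i |: S)%SET <= f S' - f (i |: S')%SET) ->
    (forall i : I, exists2 J : {set I}, (#|J| <= d)%N &
      forall S : {set I}, i \notin S -> [disjoint S & J] ->
        f S - f (i |: S)%SET <= p * f S) ->
  forall (i : I) (S : {set I}), q * f S <= f (i |: S)%SET.
Proof.
move=> /andP[q_ge0 q_le1] p_le f_ge0 f_sub f_loc i S.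
elim: {S}_.+1 {-2}S (ltnSn #|S|) i => // k IHk S Sk i.
have [iS|iS] := boolP (i \in S).
  by rewrite (finset.setUidPr _) ?finset.sub1set// ler_piMl.
have [J Jd locJ] := f_loc i.
have loc : f S - f (i |: S)%SET <= p * f (S :\: J)%SET.
  apply: le_trans (f_sub _ _ _ (finset.subsetDl S J)) (locJ _ _ _).
    by rewrite inE negb_and iS orbT.
  by rewrite disjoint_subset; apply/fintype.subsetP => x; rewrite !inE => /andP[].
(* Rebuild [S] from [S :\: J] by adding the elements of [S :&: J]; every intermediate set is smaller
   than [S], so the induction hypothesis applies to it. *)
have chain : q ^+ #|(S :&: J)%SET| * f (S :\: J)%SET <= f S.
  rewrite -[in leRHS](finset.setID S J); apply: setfun_ge_chain => //.
    by rewrite disjoint_subset; apply/fintype.subsetP => x; rewrite !inE => /andP[_ ->].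
  move=> j W; rewrite finset.setID => /proper_card WS.
  by apply: IHk; exact: leq_trans WS _.
have cJ : (#|(S :&: J)%SET| <= d)%N.
  exact: leq_trans (subset_leq_card (finset.subsetIr _ _)) Jd.
have qd : q ^+ d <= q ^+ #|(S :&: J)%SET| by apply: ler_wiXn2l.
have : p * f (S :\: J)%SET <= (1 - q) * f S.
  apply: le_trans (ler_wpM2r (f_ge0 _) p_le) _.
  rewrite -mulrA; apply: ler_wpM2l; first by rewrite subr_ge0.
  by apply: le_trans chain; apply: ler_wpM2r.
by move=> /(le_trans loc); rewrite mulrBl mul1r lerD2l lerN2.
Qed.

Lemma ln1Dx_mul_le (R : realType) (x : R) : 0 <= x ->
  (1 + x) * ln (1 + x) <= x * (1 + ln (1 + x / 2)).
Proof.
move=> x_ge0.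
pose f := fun t : R => t * (1 + ln (1 + t / 2)) - (1 + t) * ln (1 + t).
pose df := fun t : R => ln (1 + t / 2) - ln (1 + t) + t / (2 + t).
have f_drv (t : R) : 0 <= t -> is_derive t 1 f (df t).
  move=> t_ge0.
  have dh : is_derive t 1 (fun t : R => ln (1 + t / 2)) ((1 + t / 2)^-1 * 2^-1).
    apply: (@is_derive1_comp _ (@ln R) (fun t : R => 1 + t / 2)).
      by apply: is_derive1_ln; lra.
    apply: is_derive_eq; rewrite /GRing.scale/=; ring.
  have dl : is_derive t 1 (fun t : R => ln (1 + t)) ((1 + t)^-1).
    rewrite -[(1 + t)^-1]mulr1.
    apply: (@is_derive1_comp _ (@ln R) (fun t : R => 1 + t)).
      by apply: is_derive1_ln; lra.
    by apply: is_derive_eq; ring.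
  apply: is_derive_eq; rewrite /df /GRing.scale/=.
  by field; apply/andP; split; apply: lt0r_neq0; lra.
have df_ge0 (t : R) : 0 <= t -> 0 <= df t.
  move=> t_ge0; rewrite /df.
  have u_ge0 : 0 <= t / (2 + t) by apply: divr_ge0; lra.
  (* The factorization [1 + t = (1 + t / 2) * (1 + t / (2 + t))] turns [df t] into [u - ln (1 + u)]
     with [u = t / (2 + t)]. *)
  have -> : ln (1 + t) = ln (1 + t / 2) + ln (1 + t / (2 + t)).
    rewrite -lnM ?posrE; [|lra|lra].
    by congr ln; field; apply: lt0r_neq0; lra.
  have : ln (1 + t / (2 + t)) <= t / (2 + t).
    by apply: le_ln1Dx; lra.
  lra.
have [|||c] := @MVT_segment R f df 0 x.
- by [].
- by move=> t; rewrite in_itv/= => /andP[t_gt0 _]; apply: f_drv; exact: ltW.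
- apply: derivable_within_continuous => t; rewrite in_itv/= => /andP[t_ge0 _].
  by have [] := f_drv t t_ge0.
rewrite in_itv/= => /andP[c_ge0 _].
rewrite /f mul0r !addr0 ln1 mulr0 !subr0 => fx.
by rewrite -subr_ge0 fx mulr_ge0// df_ge0.
Qed.

Lemma exprS_1Dinv_le (R : realType) (d : nat) : (0 < d)%N ->
  (1 + d%:R^-1) ^+ d.+1 <= expR 1 * (1 + d%:R^-1 / 2) :> R.
Proof.
move=> d_gt0; have dR_gt0 : 0 < d%:R :> R by rewrite ltr0n.
have dV_gt0 : 0 < d%:R^-1 :> R by rewrite invr_gt0.
have pos1 : 0 < 1 + d%:R^-1 :> R by lra.
have pos2 : 0 < 1 + d%:R^-1 / 2 :> R by lra.
rewrite -[1 + d%:R^-1]lnK ?posrE// -[1 + d%:R^-1 / 2]lnK ?posrE//.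
rewrite -expRM_natl -expRD ler_expR -(ler_pM2l dV_gt0).
apply: le_trans (ln1Dx_mul_le (ltW dV_gt0)).
suff -> : d%:R^-1 * (d.+1%:R * ln (1 + d%:R^-1)) =
  (1 + d%:R^-1) * ln (1 + d%:R^-1) :> R by [].
by rewrite -natr1; field; rewrite lt0r_neq0.
Qed.

Local Open Scope classical_set_scope.

Lemma fin_bigcap_sigma_algebra (T : pointedType) (G : set (set T)) (I : Type)
    (D : set I) (F : I -> set T) :
  finite_set D -> (forall i, D i -> G (~` F i)) ->
  <<s G >> (\bigcap_(i in D) F i).
Proof.
move=> finD GF; apply: (@fin_bigcap_measurable _ (g_sigma_algebraType G)) => //.
move=> i Di; rewrite -[F i]setCK; apply: measurableC.
by apply: sub_sigma_algebra; exact: GF.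
Qed.

Lemma local_lemma (R : realType) (disp : measure_display)
    (T : measurableType disp) (P : probability T R)
    (n : nat) (A : 'I_n -> set T) (d : nat) (p q : R) :
    (forall i, measurable (A i)) ->
    (forall i, independent_but_for_at_most P A d i) ->
    (forall i, (P (A i) <= p%:E)%E) ->
    0 <= q <= 1 -> p <= (1 - q) * q ^+ d ->
  ((q ^+ n)%:E <= P (\bigcap_(i in [set: 'I_n]) ~` A i))%E.
Proof.
move=> mA indepA A_le q01 p_le.
pose N (S : {set 'I_n}) := \bigcap_(j in [set` S]) ~` A j.
have mN S : measurable (N S).
  by apply: fin_bigcap_measurable => // j _; exact: measurableC.
pose f S := fine (P (N S)).
have fE S : (f S)%:E = P (N S) by rewrite /f fineK// fin_num_measure.
have NU1 (i : 'I_n) S : N (i |: S)%SET = N S `\` A i.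
  rewrite /N setDE setIC -(bigcap_setU1 (fun j => ~` A j)); congr bigcap.
  by apply/seteqP; split => j /=; rewrite !inE => /predU1P.
(* Both hypotheses on differences of [f] are read off from this identity. *)
have fB (i : 'I_n) S : f S - f (i |: S)%SET = fine (P (A i `&` N S)).
  have mI : measurable (A i `&` N S) by exact: measurableI.
  apply: EFin_inj; rewrite fineK ?fin_num_measure// EFinB !fE NU1 setIC.
  rewrite (measureDI P (mN S) (mA i)) addeAC subee ?add0e//.
  by rewrite fin_num_measure//; exact: measurableD.
have f_ge0 S : 0 <= f S by exact: fine_ge0.
have f_step : forall (i : 'I_n) (S : {set 'I_n}), q * f S <= f (i |: S)%SET.
  apply: (setfun_local_lemma q01 p_le f_ge0) => [i S S' S'S|i].
    rewrite !fB; apply: fine_le; rewrite ?fin_num_measure//;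
      try exact: measurableI.
    apply: le_measure; rewrite ?inE; try exact: measurableI.
    by apply: setIS => t NSt j /= jS'; apply: NSt; exact: (fintype.subsetP S'S).
  have [J [_ Jd indJ]] := indepA i; exists J => // S iS dSJ.
  rewrite fB indJ; last first.
    apply: fin_bigcap_sigma_algebra => // j /= jS.
    exists j; last by rewrite setCK.
    split; first by apply: contraNneq iS => <-.
    by rewrite (disjointFr dSJ jS).
  rewrite fineM ?fin_num_measure//; apply: ler_wpM2r; first exact: f_ge0.
  by rewrite -lee_fin fineK ?fin_num_measure.
(* Starting from the empty set, where [f] is 1, all [n] indices are added. *)
have := @setfun_ge_chain R _ f q [set: 'I_n]%SET finset.set0.
rewrite finset.setU0 cardsT card_ord => H.
have -> : \bigcap_(i in [set: 'I_n]) ~` A i = N [set: 'I_n]%SET.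
  by congr bigcap; apply/seteqP; split => j //= _; rewrite inE.
have N0 : f finset.set0 = 1.
  apply: EFin_inj; rewrite fE -(@probability_setT _ _ _ P); congr (P _).
  by rewrite -subTset => t _ j /=; rewrite inE.
rewrite -fE lee_fin -[leLHS]mulr1 -N0; apply: H.
- by have /andP[] := q01.
- by rewrite disjoint_subset; apply/fintype.subsetP => i; rewrite !inE.
- by move=> i W _; exact: f_step.
Qed.

Theorem corollary2 (R : realType) (disp : measure_display)
    (T : measurableType disp) (P : probability T R)
    (n : nat) (A : 'I_n -> set T) (d : nat) (p : R)
    (n_ge1 : (1 <= n)%N) (d_ge1 : (1 <= d)%N)
    (A_event : forall i : 'I_n, measurable (A i))
    (A_indep : forall i : 'I_n, independent_but_for_at_most P A d i)
    (A_le_p : forall i : 'I_n, (P (A i) <= p%:E)%E)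
    (lll_cond : expR 1 * p * (d%:R + 1 / 2) <= 1) :
  (((d%:R / (d%:R + 1)) ^+ n)%:E <= P (\bigcap_(i in [set: 'I_n]) ~` A i))%E /\
  expR (- (n%:R / d%:R)) < (d%:R / (d%:R + 1)) ^+ n :> R.
Proof.
have dR_gt0 : 0 < d%:R :> R by rewrite ltr0n.
have dV_gt0 : 0 < d%:R^-1 :> R by rewrite invr_gt0.
have qE : d%:R / (d%:R + 1) = (1 + d%:R^-1)^-1 :> R.
  by field; rewrite !lt0r_neq0 // addr_gt0.
have q_gt0 : 0 < (1 + d%:R^-1)^-1 :> R by rewrite invr_gt0 addr_gt0.
split.
  (* Since [n >= 1], some event exists, and its probability bounds [p] from below. *)
  have p_ge0 : 0 <= p.
    by rewrite -lee_fin; apply: le_trans (A_le_p (Ordinal n_ge1)).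
  apply: (local_lemma A_event A_indep A_le_p).
    by rewrite qE ltW//= invf_le1 ?lerDl ?addr_gt0// ltW.
  (* With [1 - q = q / d], the goal becomes [p * (1 + 1 / d) ^ (d + 1) * d <= 1]. *)
  have -> : 1 - d%:R / (d%:R + 1) = d%:R^-1 * (d%:R / (d%:R + 1)) :> R.
    by field; rewrite !lt0r_neq0 // addr_gt0.
  rewrite -mulrA -exprS qE exprVn -ler_pdivrMr ?invr_gt0 ?exprn_gt0 ?addr_gt0//.
  rewrite invrK -(ler_pM2r dR_gt0) mulVf ?lt0r_neq0//.
  apply: le_trans lll_cond.
  rewrite [leRHS](_ : _ = p * (expR 1 * (1 + d%:R^-1 / 2)) * d%:R).
    by rewrite ler_pM2r// ler_wpM2l// exprS_1Dinv_le.
  by field; rewrite lt0r_neq0.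
(* After inversion this is [(1 + 1 / d) ^ n < expR (1 / d) ^ n]; strictness passes to the powers
   because [n >= 1]. *)
rewrite qE exprVn expRN expRM_natl ltf_pV2 ?posrE ?exprn_gt0 ?expR_gt0 ?addr_gt0//.
rewrite ltr_pXn2r ?nnegrE ?expR_ge0 ?addr_ge0 ?(ltW dV_gt0)//.
by rewrite expR_gt1Dx// lt0r_neq0.
Qed.
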